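(* Let $r>0$ be real, and for each integer $m\ge 0$ let $V_m(r)$ be the number of lattice points in $[-r,r]^m$ visible from the origin (with $V_0(r)=0$). Then the following identities of formal power series in $u$ hold: $$\sum_{m=0}^{\infty}\frac{u^m}{m!}V_m(r)=\frac1{2u}\left(e^{(2X+1)u}-e^{(2X-1)u}\right)$$ and $$\sum_{m=0}^{\infty}u^{m+1}V_m(r)=\frac12\log \frac{1-(2X-1)u}{1-(2X+1)u},$$ where the right-hand sides are understood symbolically: each is expanded as a formal power series in $u$ whose coefficients are polynomials in the indeterminate $X$, and then, in each coefficient (linearly), $X^i$ is replaced by $i\sum_{1\le n\le r}J_{i-1}(n)$ for every $i\ge 1$, and $X^0$ is replaced by $0$.
   Context: A lattice point $(x_1,\ldots,x_m)\in\mathbb{Z}^m$ is visible from the origin if $\gcd(x_1,\ldots,x_m)=1$. For $m\ge1$, $V_m(r)$ is the number of $(x_1,\ldots,x_m)\in\mathbb{Z}^m$ with $\gcd(x_1,\ldots,x_m)=1$ and $|x_i|\le r$ for all $1\le i\le m$; $V_0(r)=0$ by convention (there is no visible point for $m=0$). The Jordan totient function is defined for $m\ge1$ and positive integers $n$ by $$J_m(n)=|\{(x_1,\ldots,x_m)\in\mathbb{Z}^m : \gcd(x_1,\ldots,x_m,n)=1,\ 1\le x_i\le n\ (1\le i\le m)\}|,$$ and $J_0(n)=1$ if $n=1$, $J_0(n)=0$ if $n\ne1$. Formally, let $L:\mathbb{Q}[X]\to\mathbb{Q}$ be the $\mathbb{Q}$-linear map with $L(X^0)=0$ and $L(X^i)=i\sum_{1\le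 n\le r}J_{i-1}(n)$ for $i\ge1$; the right-hand sides are obtained by applying $L$ to each coefficient of the corresponding power series in $\mathbb{Q}[X][[u]]$. Here $e^{z}=\sum_{k\ge0} z^k/k!$, and $\log\frac{1-(2X-1)u}{1-(2X+1)u}=\log(1-(2X-1)u)-\log(1-(2X+1)u)$ with $\log(1-z)=-\sum_{k\ge1}z^k/k$. *)

(* Defs.v *)
From HB Require Import structures.
From mathcomp Require Import all_boot all_order all_algebra finmap.
From mathcomp Require Import boolp classical_sets cardinality reals.

Set Implicit Arguments.
Unset Strict Implicit.
Unset Printing Implicit Defensive.

Import Order.TTheory GRing.Theory Num.Theory.

Local Open Scope classical_set_scope.
Local Open Scope ring_scope.

(* For m = 0 the gcd is 0, the neutral element of gcdn. *)
Definition gcd_coords (m : nat) (x : {ffun 'I_m -> int}) : nat :=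
  \big[gcdn/0%N]_(i < m) `|x i|%N.

Definition visible (m : nat) (x : {ffun 'I_m -> int}) : Prop :=
  gcd_coords x = 1%N.

Definition visible_points (R : realType) (m : nat) (r : R) :
    set {ffun 'I_m -> int} :=
  [set x | visible x /\ forall i, `|x i|%:~R <= r].
Arguments visible_points {R} m r.

(* [fset_set] returns the empty set on infinite sets; the sets counted here
   are finite, see [finite_visible_points] and [finite_jordan_points]. *)
Definition V (R : realType) (m : nat) (r : R) : nat :=
  #|` fset_set (visible_points m r)|%fset.

Definition jordan_points (m n : nat) : set {ffun 'I_m -> int} :=
  [set x | gcdn (gcd_coords x) n = 1%N /\ forall i, 1 <= x i <= n%:Z].
Arguments jordan_points : clear implicits.

Definition jordan (m n : nat) : nat :=
  #|` fset_set (jordan_points m n)|%fset.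

(* For r >= 0, the integers 1 <= n <= r are those with 1 <= n <= truncn r
   ([truncn_ge_nat]). *)
Definition L_monomial (R : realType) (r : R) (i : nat) : rat :=
  if i is j.+1 then j.+1%:R * \sum_(1 <= n < (Num.truncn r).+1) (jordan j n)%:R
  else 0.

Definition L (R : realType) (r : R) (p : {poly rat}) : rat :=
  \sum_(i < size p) p`_i * L_monomial r i.

(* A formal power series in u is its sequence of coefficients; sums and scalar
   multiples are the pointwise ones, \+, \- and *: lifted as \*:. *)
Definition fps (A : Type) : Type := nat -> A.

Definition fps_one (A : pzRingType) : fps A := fun n => (n == 0%N)%:R.
Arguments fps_one : clear implicits.

Definition fps_mul (A : pzRingType) (f g : fps A) : fps A :=
  fun n => \sum_(i < n.+1) f i * g (n - i)%N.

Definition fps_pow (A : pzRingType) (f : fps A) (k : nat) : fps A :=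
  iter k (fps_mul f) (fps_one A).

(* \sum_k a_k z^k for a series z with zero constant term: z^k then has no
   coefficient of degree < k, so the terms k > n do not contribute to the
   coefficient of u^n. *)
Definition fps_subst (A : algType rat) (a : nat -> rat) (z : fps A) : fps A :=
  fun n => \sum_(k < n.+1) a k *: fps_pow z k n.

Definition fps_exp (A : algType rat) (z : fps A) : fps A :=
  fps_subst (fun k => (k`!%:R)^-1) z.

(* log (1 - z) = - \sum_(k >= 1) z^k / k; the k = 0 term vanishes because
   0^-1 = 0 in rat. *)
Definition fps_log1B (A : algType rat) (z : fps A) : fps A :=
  fps_subst (fun k => - (k%:R)^-1) z.

(* The series c * u *)
Definition fps_linear (A : pzRingType) (c : A) : fps A :=
  fun n => if n == 1%N then c else 0.

Definition fps_mulu (A : pzRingType) (f : fps A) : fps A :=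
  fun n => if n is k.+1 then f k else 0.

(* Division by u, for series with zero constant term, see [fps_divuK]. *)
Definition fps_divu (A : pzRingType) (f : fps A) : fps A := fun n => f n.+1.

Definition ogf (a : nat -> rat) : fps rat := a.

Definition egf (a : nat -> rat) : fps rat := fun m => (m`!%:R)^-1 * a m.

Definition L_fps (R : realType) (r : R) (f : fps {poly rat}) : fps rat :=
  fun n => L r (f n).

Lemma finite_box (m N : nat) (S : set {ffun 'I_m -> int}) :
  (forall x, S x -> forall i, (`|x i| <= N)%N) -> finite_set S.
Proof.
move=> SN.
pose f (y : {ffun 'I_m -> 'I_(N + N).+1}) : {ffun 'I_m -> int} :=
  [ffun i => (y i)%:Z - N%:Z].
have fin : finite_set (f @` [set: {ffun 'I_m -> 'I_(N + N).+1}]).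
  by apply: finite_image; exact: finite_finset.
apply: sub_finite_set fin => x Sx.
exists [ffun i => inord (absz (x i + N%:Z))] => //.
apply/ffunP => i; rewrite !ffunE.
have xN : `|x i| <= N%:Z by rewrite -abszE lez_nat SN.
have /andP[x1 x2] : - N%:Z <= x i <= N%:Z by rewrite -ler_norml.
have x0 : 0 <= x i + N%:Z by rewrite -lerBlDr sub0r.
rewrite inordK; last first.
  by rewrite ltnS -lez_nat gez0_abs// PoszD lerD2r.
by rewrite gez0_abs// addrK.
Qed.

Lemma finite_visible_points (R : realType) (m : nat) (r : R) :
  finite_set (visible_points m r).
Proof.
apply: (@finite_box m (Num.truncn r)) => x [_ xr] i.
have r0 : 0 <= r by apply: le_trans (xr i); rewrite ler0z.
by rewrite truncn_ge_nat//; move: (xr i); rewrite -abszE.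
Qed.

Lemma finite_jordan_points (m n : nat) : finite_set (jordan_points m n).
Proof.
apply: (@finite_box m n) => x [_ xn] i.
have /andP[x1 x2] := xn i.
by rewrite -lez_nat gez0_abs//; exact: le_trans x1.
Qed.

Lemma gcd_coords0 (x : {ffun 'I_0 -> int}) : gcd_coords x = 0%N.
Proof. by rewrite /gcd_coords big_ord0. Qed.

Lemma V0 (R : realType) (r : R) : V 0 r = 0%N.
Proof.
rewrite /V (_ : visible_points 0 r = set0) ?fset_set0 ?cardfs0//.
by apply/seteqP; split => x //= -[]; rewrite /visible gcd_coords0.
Qed.

Lemma jordan0 (n : nat) : jordan 0 n = (n == 1%N).
Proof.
rewrite /jordan; have [->|n1] := eqVneq n 1%N.
  rewrite (_ : jordan_points 0 1 = [set [ffun=> 0]]) ?fset_set1 ?cardfs1//.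
  apply/seteqP; split => x /= _; first by apply/ffunP => -[].
  by split; [rewrite gcd_coords0|case].
rewrite (_ : jordan_points 0 n = set0) ?fset_set0 ?cardfs0//.
apply/seteqP; split => x //= -[]; rewrite gcd_coords0 gcd0n => /eqP.
by rewrite (negPf n1).
Qed.

Lemma L_wide (R : realType) (r : R) (N : nat) (p : {poly rat}) :
  (size p <= N)%N -> L r p = \sum_(i < N) p`_i * L_monomial r i.
Proof.
move=> pN; rewrite /L -!(big_mkord xpredT (fun i => p`_i * L_monomial r i)).
rewrite [RHS](big_cat_nat (leq0n _) pN) /=.
rewrite [X in _ = _ + X]big_nat_cond [X in _ = _ + X]big1 ?addr0//.
by move=> i /andP[/andP[pi _] _]; rewrite nth_default// mul0r.
Qed.

Lemma L_is_linear (R : realType) (r : R) : linear_for *%R (L r).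
Proof.
move=> a p q; pose N := maxn (size (a *: p + q)) (maxn (size p) (size q)).
rewrite (@L_wide _ _ N) ?leq_maxl// (@L_wide _ _ N p); last first.
  by rewrite !leq_max leqnn orbT.
rewrite (@L_wide _ _ N q); last by rewrite !leq_max leqnn !orbT.
rewrite mulr_sumr -big_split; apply: eq_bigr => i _ /=.
by rewrite coefD coefZ mulrDl mulrA.
Qed.

HB.instance Definition _ (R : realType) (r : R) :=
  GRing.isLinear.Build rat {poly rat} rat *%R (L r) (@L_is_linear R r).

Lemma L_Xn (R : realType) (r : R) (i : nat) : L r 'X^i = L_monomial r i.
Proof.
rewrite /L size_polyXn big_ord_recr /= big1 ?add0r => [|j _].
  by rewrite coefXn eqxx mul1r.
by rewrite coefXn ltn_eqF ?ltn_ord// mul0r.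
Qed.

Lemma fps_divuK (A : pzRingType) (f : fps A) :
  f 0%N = 0 -> fps_mulu (fps_divu f) =1 f.
Proof. by move=> f0 [|n]. Qed.

Lemma fps_muluE (A : pzRingType) (f : fps A) :
  fps_mul (fps_linear 1) f =1 fps_mulu f.
Proof.
move=> [|n]; rewrite /fps_mul /fps_mulu /fps_linear.
  by rewrite big_ord1 mul0r.
rewrite 2!big_ord_recl mul0r add0r mul1r /= subn1 big1 ?addr0// => i _.
by rewrite mul0r.
Qed.

Lemma fps_exp0 (A : algType rat) (z : fps A) : fps_exp z 0%N = 1.
Proof. by rewrite /fps_exp /fps_subst big_ord1 invr1 scale1r. Qed.

(* Main.v *)
(* Both identities say that V_m(r) is the image under L of
   ((2X+1)^(m+1) - (2X-1)^(m+1)) / (2(m+1)). For n >= 1, the visible points of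
   sup norm n are the points x with gcd(x, n) = 1 in [-n, n]^m but not in
   [-(n-1), n-1]^m. Write the indicator of gcd(g, n) = 1 as a combination
   sum c_d [d | g] over divisors d of n. The number of multiples of d in [1, n],
   [-n, n] and [-(n-1), n-1] is q, 2q+1 and 2q-1 respectively, with q = n/d.
   Hence J_k(n) = sum c_d q^k, and the number of visible points of sup norm n is
   sum c_d ((2q+1)^m - (2q-1)^m), i.e. the image of (2X+1)^m - (2X-1)^m under
   X^k |-> J_k(n). Sum over 1 <= n <= r. *)
Require Import Defs.
From mathcomp Require Import all_boot all_order all_algebra finmap.
From mathcomp Require Import classical_sets cardinality reals.
From mathcomp Require Import zify ring.

Set Implicit Arguments.
Unset Strict Implicit.
Unset Printing Implicit Defensive.

Import Order.TTheory GRing.Theory Num.Theory.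

Local Open Scope ring_scope.

(** * Integer boxes and counts of points in them *)

Definition box (a : int) (K m : nat) : {fset {ffun 'I_m -> int}} :=
  [fset [ffun i => (a + ((y : {ffun 'I_m -> 'I_K}) i)%:Z)%R]
     | y : {ffun 'I_m -> 'I_K}]%fset.

Lemma in_box a K m (x : {ffun 'I_m -> int}) :
  (x \in box a K m) = [forall i, a <= x i < a + K%:Z].
Proof.
apply/imfsetP/forallP => /= [[y _ ->] i|ax].
  by rewrite ffunE; have := ltn_ord (y i); lia.
have xK i : (`|x i - a| < K)%N by have := ax i; lia.
exists [ffun i => Ordinal (xK i)] => //.
by apply/ffunP => i; rewrite !ffunE /=; have := ax i; lia.
Qed.

Lemma big_box (A : nmodType) a K m (F : {ffun 'I_m -> int} -> A) :
  \sum_(x <- box a K m) F x =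
  \sum_(y : {ffun 'I_m -> 'I_K}) F [ffun i => a + (y i)%:Z].
Proof.
rewrite big_imfset /=; first by rewrite big_enum.
move=> y z _ _ /ffunP yz; apply/ffunP => i; apply/val_inj.
by have := yz i; rewrite !ffunE => /addrI [].
Qed.

(** [fset_set] is empty on infinite sets; matching [S] with a filtered finite box rules this default
    out and turns the cardinal into a sum of indicators. *)
Lemma card_fset_set_box m (S : set {ffun 'I_m -> int}) a K
    (P : pred {ffun 'I_m -> int}) :
  (forall x, S x <-> P x /\ forall i, a <= x i < a + K%:Z) ->
  (#|` fset_set S|%fset)%:R = \sum_(x <- box a K m) (P x)%:R :> rat.
Proof.
move=> SP; have -> : fset_set S = [fset x in box a K m | P x]%fset.
  have Sbox : S = [set` [fset x in box a K m | P x]%fset]%classic.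
    apply/seteqP; split=> x; rewrite /= !inE in_box.
      by move=> /SP[Px xi]; rewrite Px andbT; apply/forallP.
    by move=> /andP[/forallP xi Px]; apply/SP.
  by rewrite Sbox set_fsetK.
rewrite card_fset_sum1 natr_sum big_fset /= big_mkcond /=.
by apply: eq_bigr => x _; case: (P x).
Qed.

Lemma V_box (R : realType) m (r : R) : 0 < r ->
  (V m r)%:R = \sum_(x <- box (- (Num.truncn r)%:Z) (Num.truncn r).*2.+1 m)
    (gcd_coords x == 1%N)%:R :> rat.
Proof.
move=> r0; apply: card_fset_set_box => x; split=> -[x1 xr].
  split=> [|i]; first exact/eqP.
  have : (`|x i| <= Num.truncn r)%N.
    by rewrite truncn_ge_nat ?(ltW r0) //; have := xr i; rewrite -abszE.
  lia.
split=> [|i]; first exact/eqP.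
by rewrite -abszE -pmulrn -truncn_ge_nat ?(ltW r0) //; have := xr i; lia.
Qed.

Lemma jordan_box m n :
  (jordan m n)%:R = \sum_(x <- box 1 n m) (coprime (gcd_coords x) n)%:R :> rat.
Proof.
apply: card_fset_set_box => x; split=> -[xn xi].
  by split=> [|i]; [exact/eqP|have := xi i; lia].
by split=> [|i]; [exact/eqP|have := xi i; lia].
Qed.

(** * Multiples of d among consecutive integers *)

Definition num_multiples (a : int) (K d : nat) : nat :=
  (\sum_(j < K) (d%:Z %| (a + j%:Z)%R)%Z)%N.

Lemma num_multiplesS a K d :
  num_multiples a K.+1 d = (num_multiples a K d + (d%:Z %| (a + K%:Z)%R)%Z)%N.
Proof. by rewrite /num_multiples big_ord_recr. Qed.

Lemma num_multiplesD a K K' d : num_multiples a (K + K') d =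
  (num_multiples a K d + num_multiples (a + K%:Z)%R K' d)%N.
Proof.
elim: K' => [|K' IH]; first by rewrite addn0 /num_multiples big_ord0 addn0.
by rewrite addnS !num_multiplesS IH PoszD !addrA addnA.
Qed.

Lemma num_multiples_period a d : (0 < d)%N -> num_multiples a d d = 1%N.
Proof.
(* The residue of [- a] is the only offset j < d with d dividing a + j. *)
move=> d0; pose k := `|(- a %% d%:Z)%Z|%N.
have dn0 : d%:Z != 0 by lia.
have kE : k%:Z = (- a %% d%:Z)%Z by rewrite gez0_abs // modz_ge0.
have kd : (k < d)%N by rewrite -ltz_nat kE ltz_pmod.
have dvdE (j : 'I_d) : (d%:Z %| a + j%:Z)%Z = (j == Ordinal kd).
  rewrite -[a]opprK addrC -eqz_mod_dvd -kE modz_small //.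
  by have := ltn_ord j; lia.
rewrite /num_multiples (bigD1 (Ordinal kd)) // dvdE eqxx big1 // => j.
by rewrite dvdE => /negPf ->.
Qed.

Lemma num_multiples_periods a d q :
  (0 < d)%N -> num_multiples a (q * d) d = q.
Proof.
move=> d0; elim: q a => [|q IH] a; first by rewrite /num_multiples big_ord0.
by rewrite mulSn num_multiplesD num_multiples_period // IH.
Qed.

(** The interval consists of 2q full periods followed by the endpoint qd, itself a multiple. *)
Lemma num_multiples_sym q d : (0 < d)%N ->
  num_multiples (- (q * d)%:Z) (q * d).*2.+1 d = q.*2.+1.
Proof.
move=> d0; rewrite num_multiplesS doubleMl num_multiples_periods //.
rewrite (_ : - _ + _ = (q%:Z * d%:Z)); last by lia.
by rewrite dvdz_mull // addn1.
Qed.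

(** Prepending the multiple -(n+1) = -qd completes the interval to 2q full periods, so 2q - 1
    multiples remain without it. *)
Lemma num_multiples_sym_pred q d n : (0 < d)%N -> (q * d = n.+1)%N ->
  num_multiples (- n%:Z) n.*2.+1 d = q.*2.-1.
Proof.
move=> d0 qd; have := num_multiples_periods (- (q * d)%:Z) q.*2 d0.
rewrite -doubleMl qd (_ : n.+1.*2 = 1 + n.*2.+1)%N //.
rewrite num_multiplesD (_ : - n.+1%:Z + 1%:Z = - n%:Z); last by lia.
rewrite {1}/num_multiples big_ord1 addr0.
rewrite (_ : - n.+1%:Z = (- q%:Z) * d%:Z); last by lia.
by rewrite dvdz_mull // add1n => <-.
Qed.

(** * Sums of divisibility and coprimality indicators over boxes *)

Lemma dvdn_gcd_coords m (x : {ffun 'I_m -> int}) (d : nat) :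
  ((d %| gcd_coords x)%N)%:R = \prod_i (d%:Z %| x i)%Z%:R :> rat.
Proof.
have [/dvdn_biggcdP dx|dx] := boolP (d %| gcd_coords x)%N.
  by rewrite big1 // => i _; rewrite dvdzE absz_nat dx.
case: (pickP (fun i => ~~ (d %| `|x i|)%N)) => [i /negPf di|dxi].
  by rewrite (bigD1 i) //= dvdzE absz_nat di mul0r.
by case/dvdn_biggcdP: dx => i _; move: (dxi i) => /negbFE.
Qed.

(** The indicator of d | gcd is a product over the coordinates, so the sum over the box factors into
    m equal sums. *)
Lemma sum_box_dvd a K m d :
  \sum_(x <- box a K m) (d %| gcd_coords x)%N%:R =
  (num_multiples a K d)%:R ^+ m :> rat.
Proof.
rewrite big_box /num_multiples natr_sum -[in RHS](card_ord m) -prodr_const.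
rewrite bigA_distr_bigA /=; apply: eq_bigr => y _; rewrite dvdn_gcd_coords.
by apply: eq_bigr => i _; rewrite ffunE.
Qed.

(* Inclusion-exclusion: expand the product of 1 - [p | g] over the primes p
   dividing n; the pairs (c, d) of s stand for the terms c [d | g]. *)
Lemma coprime_dvd_combination n : (0 < n)%N ->
  exists2 s : seq (rat * nat), (forall t, t \in s -> (t.2 %| n)%N) &
    forall g, (coprime g n)%:R = \sum_(t <- s) t.1 * (t.2 %| g)%N%:R.
Proof.
move=> n0.
have [s sn sE] : exists2 s : seq (rat * nat),
    (forall t, t \in s -> (t.2 %| n)%N) &
    forall g, (all (fun p => ~~ (p %| g)%N) (primes n))%:R =
      \sum_(t <- s) t.1 * (t.2 %| g)%N%:R.
  have : {in primes n, forall p, (p %| n)%N}.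
    by move=> p; rewrite mem_primes => /and3P[].
  elim: (primes n) => [|p ps IH] pn.
    exists [:: (1, 1%N)] => [t|g].
      by rewrite inE => /eqP ->; rewrite dvd1n.
    by rewrite big_seq1 mul1r dvd1n.
  case: IH => [q qps|s sn sE]; first by apply: pn; rewrite inE qps orbT.
  (* Multiplying by 1 - [p | g] adds the terms -c [p | g] [d | g] = -c [lcm(p, d) | g]. *)
  exists (s ++ [seq (- t.1, lcmn p t.2) | t <- s]) => [t|g].
    rewrite mem_cat => /orP[/sn //|/mapP[t' /sn t'n ->]] /=.
    by rewrite dvdn_lcm t'n pn // mem_head.
  rewrite big_cat big_map /= -big_split /=.
  rewrite -mulnb natrM sE mulr_sumr; apply: eq_bigr => t _; rewrite dvdn_lcm.
  by case: (p %| g)%N; case: (t.2 %| g)%N => /=; ring.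
exists s => // g; rewrite -sE; congr (_%:R); congr nat_of_bool.
apply/idP/allP => [gn p|gn].
  rewrite mem_primes => /and3P[pp _ pn]; apply/negP => pg.
  have : (p %| gcdn g n)%N by rewrite dvdn_gcd pg.
  by rewrite (eqP gn) dvdn1 => /eqP p1; rewrite p1 in pp.
apply: contraT; rewrite /coprime => g1.
have pg : (pdiv (gcdn g n) %| gcdn g n)%N by exact: pdiv_dvd.
have := gn (pdiv (gcdn g n)); rewrite dvdn_gcd in pg; case/andP: pg => pg pn.
rewrite mem_primes n0 pn pg pdiv_prime => [/(_ isT)//|].
by rewrite ltn_neqAle eq_sym g1 gcdn_gt0 n0 orbT.
Qed.

(* [L] differentiates before substituting: it sends X^i to the sum over n of
   i * J_{i-1}(n), the image of (X^i)' under X^k |-> J_k(n). *)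
Definition umbral_jordan (n : nat) (p : {poly rat}) : rat :=
  \sum_(i < size p) p`_i * (jordan i n)%:R.

Lemma L_deriv (R : realType) (r : R) (p : {poly rat}) :
  L r p = \sum_(1 <= n < (Num.truncn r).+1) umbral_jordan n p^`().
Proof.
(* In characteristic 0, differentiation kills only the constant term, which [L] kills as well. *)
have size_p : (size p <= (size p^`()).+1)%N.
  apply/leq_sizeP => -[//|j] /leq_sizeP/(_ j (leqnn j))/eqP.
  by rewrite coef_deriv mulrn_eq0 /= => /eqP.
rewrite (L_wide r size_p) big_ord_recl mulr0 add0r.
rewrite /umbral_jordan exchange_big /=; apply: eq_bigr => i _.
rewrite mulrA mulr_natr -coef_deriv mulr_sumr.
by apply: eq_bigr => n _.
Qed.

Lemma sum_box_coprime n (s : seq (rat * nat)) a K m :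
  (forall g, (coprime g n)%:R = \sum_(t <- s) t.1 * (t.2 %| g)%N%:R) ->
  \sum_(x <- box a K m) (coprime (gcd_coords x) n)%:R =
  \sum_(t <- s) t.1 * (num_multiples a K t.2)%:R ^+ m :> rat.
Proof.
move=> sE; under eq_bigr do rewrite sE.
rewrite exchange_big /=; apply: eq_bigr => t _.
by rewrite -mulr_sumr sum_box_dvd.
Qed.

(** Cutting [1, n] into n/d blocks of length d gives J_i(n) = sum c_d (n/d)^i, so by linearity the
    substitution is a weighted sum of evaluations. *)
Lemma umbral_jordanE n (s : seq (rat * nat)) (p : {poly rat}) : (0 < n)%N ->
  (forall t, t \in s -> (t.2 %| n)%N) ->
  (forall g, (coprime g n)%:R = \sum_(t <- s) t.1 * (t.2 %| g)%N%:R) ->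
  umbral_jordan n p = \sum_(t <- s) t.1 * p.[(n %/ t.2)%:R].
Proof.
move=> n0 sn sE; rewrite /umbral_jordan.
under eq_bigr => i _ do rewrite jordan_box (sum_box_coprime _ _ _ sE) mulr_sumr.
rewrite exchange_big /=; apply: eq_big_seq => t ts.
rewrite horner_coef mulr_sumr; apply: eq_bigr => i _.
rewrite -[in num_multiples _ _ _](divnK (sn t ts)) num_multiples_periods.
  by rewrite mulrCA.
by apply: dvdn_gt0 (sn t ts).
Qed.

Lemma umbral_jordan_box n m :
  umbral_jordan n.+1 ((2 * 'X + 1) ^+ m - (2 * 'X - 1) ^+ m) =
  \sum_(x <- box (- n.+1%:Z) n.+1.*2.+1 m) (coprime (gcd_coords x) n.+1)%:R -
  \sum_(x <- box (- n%:Z) n.*2.+1 m) (coprime (gcd_coords x) n.+1)%:R.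
Proof.
have [s sn sE] := coprime_dvd_combination (ltn0Sn n).
rewrite (umbral_jordanE _ _ sn sE) // !(sum_box_coprime _ _ _ sE) -sumrB.
apply: eq_big_seq => t ts; have := divnK (sn t ts).
have t0 : (0 < t.2)%N by apply: dvdn_gt0 (sn t ts).
set q := (_ %/ _)%N => qt; rewrite -mulrBr; congr (_ * _).
rewrite (num_multiples_sym_pred t0 qt) -qt num_multiples_sym //.
(* Positivity ensures that the truncated predecessor [q.*2.-1] is really 2q - 1. *)
have q0 : (0 < q)%N by rewrite lt0n; apply/negP => /eqP q0; rewrite q0 in qt.
rewrite !hornerE /=; congr (_ ^+ _ - _ ^+ _).
  by rewrite -natr1 -muln2 natrM mulrC.
apply/(@addIr _ 1); rewrite subrK natr1 prednK ?double_gt0 //.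
by rewrite -muln2 natrM mulrC.
Qed.

Lemma sum_box_visible N m :
  \sum_(x <- box (- N%:Z) N.*2.+1 m) (gcd_coords x == 1%N)%:R =
  \sum_(1 <= n < N.+1) umbral_jordan n ((2 * 'X + 1) ^+ m - (2 * 'X - 1) ^+ m).
Proof.
elim: N => [|N IH].
  (* For N = 0 the box contains only the origin, whose gcd is 0. *)
  rewrite big_nil // big_seq big1 // => x; rewrite in_box => /forallP x0.
  rewrite /gcd_coords big1 // => i _; have := x0 i; lia.
rewrite big_nat_recr //= -IH umbral_jordan_box.
(* A point of the large box outside the small one has a coordinate equal to
   N+1 or -(N+1), hence is visible iff its gcd is coprime to N+1. *)
pose F (x : {ffun 'I_m -> int}) : rat :=
  (gcd_coords x == 1%N)%:R - (coprime (gcd_coords x) N.+1)%:R.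
have : \sum_(x <- box (- N%:Z) N.*2.+1 m) F x =
       \sum_(x <- box (- N.+1%:Z) N.+1.*2.+1 m) F x.
  apply: big_fset_incl => [|x].
    apply/fsubsetP => x; rewrite !in_box => /forallP xN; apply/forallP => i.
    by have := xN i; lia.
  rewrite !in_box => /forallP xN1 /forallPn[i xN].
  have N1x : (gcd_coords x %| N.+1)%N.
    have -> : N.+1 = `|x i|%N
      by move: (x i) xN (xN1 i) => z; rewrite negb_and -ltNge -leNgt; lia.
    by rewrite /gcd_coords (bigD1 i) //= dvdn_gcdl.
  by rewrite /F /coprime (gcdn_idPl N1x) subrr.
by rewrite !sumrB addrCA => ->; rewrite addrC subrK.
Qed.

(** The factor 2(m+1) comes from the chain rule: both 2X + 1 and 2X - 1 have derivative 2. *)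
Lemma L_V (R : realType) (r : R) m : 0 < r ->
  L r ((2 * 'X + 1) ^+ m.+1 - (2 * 'X - 1) ^+ m.+1) =
  2 * m.+1%:R * (V m r)%:R.
Proof.
move=> r0; rewrite V_box // sum_box_visible L_deriv.
have -> : ((2 * 'X + 1) ^+ m.+1 - (2 * 'X - 1) ^+ m.+1 : {poly rat})^`() =
    (2 * m.+1%:R) *: ((2 * 'X + 1) ^+ m - (2 * 'X - 1) ^+ m).
  have d2X : (2 * 'X : {poly rat})^`() = 2 by rewrite mulr_natl derivMn derivX.
  rewrite derivB !deriv_exp derivB derivD d2X -polyC1 derivC addr0 subr0 /=.
  by rewrite -mulrnBl -mulrBr -natrM scaler_nat mulr_natl mulrnA.
rewrite mulr_sumr; apply: eq_bigr => n _; rewrite /umbral_jordan size_scale.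
  by rewrite mulr_sumr; apply: eq_bigr => i _; rewrite coefZ mulrA.
by rewrite mulf_neq0 // pnatr_eq0.
Qed.

(** * Exponential and logarithm of series c u *)

Lemma fps_mul_linear (A : pzRingType) (c : A) (f : fps A) n :
  fps_mul (fps_linear c) f n = if n is k.+1 then c * f k else 0.
Proof.
case: n => [|n]; rewrite /fps_mul /fps_linear; first by rewrite big_ord1 mul0r.
rewrite 2!big_ord_recl mul0r add0r /= subn1 big1 ?addr0// => i _.
by rewrite mul0r.
Qed.

Lemma fps_pow_linear (A : pzRingType) (c : A) k n :
  fps_pow (fps_linear c) k n = if n == k then c ^+ k else 0.
Proof.
elim: k n => [|k IH] n; first by rewrite /fps_pow /= /fps_one; case: eqP.
rewrite [LHS]fps_mul_linear; case: n => [//|n].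
by rewrite [X in c * X]IH eqSS exprS; case: eqP => // _; rewrite mulr0.
Qed.

(** Since (c u)^k is a monomial of degree k, only the term k = n contributes. *)
Lemma fps_subst_linear (A : algType rat) (a : nat -> rat) (c : A) n :
  fps_subst a (fps_linear c) n = a n *: c ^+ n.
Proof.
rewrite /fps_subst big_ord_recr /= fps_pow_linear eqxx big1 ?add0r // => k _.
by rewrite fps_pow_linear gtn_eqF ?ltn_ord // scaler0.
Qed.

Theorem theorem3p1 (R : realType) (r : R) (r_gt0 : 0 < r) :
  egf (fun m => (V m r)%:R)
    =1 L_fps r (fps_divu (2^-1 \*: (fps_exp (fps_linear (2 * 'X + 1))
                                    \- fps_exp (fps_linear (2 * 'X - 1)))))
  /\
  fps_mulu (ogf (fun m => (V m r)%:R))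
    =1 L_fps r (2^-1 \*: (fps_log1B (fps_linear (2 * 'X - 1))
                          \- fps_log1B (fps_linear (2 * 'X + 1)))).
Proof.
split=> m.
  (* Division by u selects the coefficient of u^(m+1), and 2(m+1) / (2 (m+1)!) = 1/m!. *)
  rewrite /L_fps /fps_divu /fps_exp /= !fps_subst_linear -scalerBr !linearZ /=.
  rewrite L_V // /egf factS natrM.
  by field; rewrite nat1r !pnatr_eq0 -lt0n fact_gt0.
rewrite /L_fps /fps_log1B /= !fps_subst_linear.
(* The constant coefficient is 0 on both sides, by the convention 0^-1 = 0. *)
case: m => [|m] /=; first by rewrite invr0 oppr0 !scale0r subrr scaler0 linear0.
rewrite !scaleNr opprK addrC -scalerBr !linearZ /= L_V // /ogf.
by field; rewrite nat1r pnatr_eq0.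
Qed.
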